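(* Let $f:\mathbb{R}^n\to\mathbb{R}^m$ be a piecewise-affine function with abs-normal form data $s,c,b,Z,L,J,Y$, and let $\tilde c,\tilde b,\tilde L,\tilde Y,\tilde Z,\tilde J$ be the associated auxiliary matrices and vectors. Then, for $x\in\mathbb{R}^n$, $f(x)=0$ if and only if there exists $w\in\mathbb{R}^s$ for which $(x,w)$ solves the mixed linear complementarity problem $$0=\tilde b+\tilde J x+\tilde Y w,\qquad 0\le w\perp \tilde c+\tilde Z x+\tilde L w\ge 0.$$ Moreover, if $m=n$ and $\tilde J$ is nonsingular, then, with $\check c:=\tilde c-\tilde Z\tilde J^{-1}\tilde b$ and $\check S:=\tilde L-\tilde Z\tilde J^{-1}\tilde Y$, one has $f(x)=0$ if and only if $$\tilde J x=-\tilde b-\tilde Y w$$ for some $w\in\mathbb{R}^s$ that solves the linear complementarity problem $$0\le w\perp \check c+\check S w\ge 0.$$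
   Context: A function $f:\mathbb{R}^n\to\mathbb{R}^m$ is piecewise affine if it is continuous and its values are chosen from finitely many affine functions, i.e. there are finitely many affine maps $f^1,\dots,f^k$ with $f(x)\in\{f^1(x),\dots,f^k(x)\}$ for every $x$. For a vector $z$, $|z|$ denotes the componentwise absolute value; vector inequalities are componentwise. For vectors $p,q$ of the same size, $0\le p\perp q\ge 0$ means $p\ge0$, $q\ge0$ and $p^{T}q=0$. Abs-normal form: $f$ has abs-normal form data consisting of $s\in\mathbb{N}$, matrices $Z\in\mathbb{R}^{s\times n}$, $J\in\mathbb{R}^{m\times n}$, $Y\in\mathbb{R}^{m\times s}$, a strictly lower triangular matrix $L\in\mathbb{R}^{s\times s}$, and vectors $c\in\mathbb{R}^s$, $b\in\mathbb{R}^m$, if for every $x\in\mathbb{R}^n$ the unique vector $z\in\mathbb{R}^s$ with $z=c+Zx+L|z|$ satisfies $f(x)=b+Jx+Y|z|$. Auxiliary quantities: $\tilde c:=(I-L)^{-1}c$, $\tilde b:=b+Y\tilde c$, $\tilde L:=(I-L)^{-1}(I+L)$, $\tilde Y:=Y(I+\tilde L)$, $\tilde Z:=(I-L)^{-1}Z$, $\tilde J:=J+Y\tilde Z$. ($I-L$ is unit lower triangular, hence invertible.) *)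

(* Defs.v *)
From HB Require Import structures.
From mathcomp Require Import all_boot all_order all_algebra.
From mathcomp Require Import all_classical all_reals topology.
From mathcomp Require Import normedtype.

Set Implicit Arguments.
Unset Strict Implicit.
Unset Printing Implicit Defensive.

Import Order.TTheory GRing.Theory Num.Theory.
Import numFieldNormedType.Exports.

Local Open Scope ring_scope.

(* R^n is the type 'cV[R]_n of column vectors, whose library topology is the
   product topology. *)

Definition piecewise_affine (R : realType) (n m : nat)
    (f : 'cV[R]_n -> 'cV[R]_m) : Prop :=
  continuous f /\
  exists (k : nat) (A : 'I_k -> 'M[R]_(m, n)) (a : 'I_k -> 'cV[R]_m),
    forall x, exists i, f x = A i *m x + a i.

(* Componentwise absolute value; `|z| on matrices is the sup norm in
   MathComp-Analysis. *)
Definition absv (R : realType) (s : nat) (z : 'cV[R]_s) : 'cV[R]_s :=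
  map_mx Num.norm z.

Definition nonnegv (R : realType) (s : nat) (p : 'cV[R]_s) : Prop :=
  forall i, 0 <= p i 0.

(* 0 <= p _|_ q >= 0 *)
Definition complementary (R : realType) (s : nat) (p q : 'cV[R]_s) : Prop :=
  [/\ nonnegv p, nonnegv q & p^T *m q = 0].

Record anf_data (R : realType) (n m s : nat) := AnfData {
  anf_c : 'cV[R]_s;
  anf_b : 'cV[R]_m;
  anf_Z : 'M[R]_(s, n);
  anf_L : 'M[R]_s;
  anf_J : 'M[R]_(m, n);
  anf_Y : 'M[R]_(m, s);
  anf_L_strict_lower : forall i j : 'I_s, (i <= j)%N -> anf_L i j = 0
}.

(* Since L is strictly lower triangular, z = c + Z x + L |z| determines z
   uniquely by forward substitution; hence quantifying universally over its
   solutions refers to "the" solution. *)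
Definition abs_normal_form (R : realType) (n m s : nat)
    (f : 'cV[R]_n -> 'cV[R]_m) (D : anf_data R n m s) : Prop :=
  forall (x : 'cV[R]_n) (z : 'cV[R]_s),
    z = anf_c D + anf_Z D *m x + anf_L D *m absv z ->
    f x = anf_b D + anf_J D *m x + anf_Y D *m absv z.

(* invmx is the identity on singular matrices; this is the genuine inverse in
   the definitions below. *)
Lemma unitmx_1subL (R : realType) (n m s : nat) (D : anf_data R n m s) :
  1%:M - anf_L D \in unitmx.
Proof.
rewrite unitmxE det_trig; last first.
  apply/is_trig_mxP => i j ltij; rewrite !mxE anf_L_strict_lower 1?ltnW //.
  by rewrite subr0 -val_eqE /= ltn_eqF.
rewrite big1 ?unitr1 // => i _.
by rewrite !mxE anf_L_strict_lower // eqxx subr0.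
Qed.

Section Auxiliary.
Variables (R : realType) (n m s : nat) (D : anf_data R n m s).

Definition tilde_c : 'cV[R]_s := invmx (1%:M - anf_L D) *m anf_c D.
Definition tilde_b : 'cV[R]_m := anf_b D + anf_Y D *m tilde_c.
Definition tilde_L : 'M[R]_s := invmx (1%:M - anf_L D) *m (1%:M + anf_L D).
Definition tilde_Y : 'M[R]_(m, s) := anf_Y D *m (1%:M + tilde_L).
Definition tilde_Z : 'M[R]_(s, n) := invmx (1%:M - anf_L D) *m anf_Z D.
Definition tilde_J : 'M[R]_(m, n) := anf_J D + anf_Y D *m tilde_Z.

Definition solves_mlcp (x : 'cV[R]_n) (w : 'cV[R]_s) : Prop :=
  0 = tilde_b + tilde_J *m x + tilde_Y *m w /\
  complementary w (tilde_c + tilde_Z *m x + tilde_L *m w).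

End Auxiliary.

Section Square.
Variables (R : realType) (n s : nat) (D : anf_data R n n s).

Definition check_c : 'cV[R]_s :=
  tilde_c D - tilde_Z D *m invmx (tilde_J D) *m tilde_b D.
Definition check_S : 'M[R]_s :=
  tilde_L D - tilde_Z D *m invmx (tilde_J D) *m tilde_Y D.

Definition solves_lcp (w : 'cV[R]_s) : Prop :=
  complementary w (check_c + check_S *m w).

End Square.

(* Main.v *)
(* Write z for the solution of z = c + Z x + L |z| and split it as z = u - w
   into its positive and negative parts, so that |z| = u + w. Then the equation
   becomes (I - L) u = c + Z x + (I + L) w, i.e. u = c~ + Z~ x + L~ w, and
   f(x) = b + J x + Y (u + w) = b~ + J~ x + Y~ w. Conversely, complementary
   vectors u, w are the positive and negative parts of u - w. If J~ is
   nonsingular, x can be eliminated from the complementarity condition. *)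

Require Import Defs.
From HB Require Import structures.
From mathcomp Require Import all_boot all_order all_algebra.
From mathcomp Require Import all_classical all_reals topology.
From mathcomp Require Import normedtype.

Set Implicit Arguments.
Unset Strict Implicit.
Unset Printing Implicit Defensive.

Import Order.TTheory GRing.Theory Num.Theory.
Import numFieldNormedType.Exports.

Local Open Scope ring_scope.

Section Complementarity.
Variables (R : realType) (s : nat).
Implicit Types w u z : 'cV[R]_s.

(** A sum of nonnegative products vanishes only if every term does, so orthogonality can be used one
    coordinate at a time. *)
Lemma complementaryP w u :
  complementary w u <->
  forall i, [/\ 0 <= w i 0, 0 <= u i 0 & w i 0 * u i 0 = 0].
Proof.
split=> [[w0 u0 wu0] i | wu].
  split=> //.
  have /matrixP/(_ 0 0) := wu0; rewrite !mxE.
  under eq_bigr do rewrite mxE.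
  by move/psumr_eq0P => -> // j _; rewrite mulr_ge0.
split=> [i | i |]; [by case: (wu i) | by case: (wu i) |].
apply/matrixP => i j; rewrite !mxE big1 // => k _.
by rewrite !ord1 mxE; case: (wu k).
Qed.

(** In each coordinate one of the two entries is zero and the other is its own absolute value up to
    sign. *)
Lemma absv_sub_complementary w u :
  complementary w u -> absv (u - w) = u + w.
Proof.
move/complementaryP=> wu; apply/matrixP => i j; rewrite ord1 !mxE.
have [w0 u0 /eqP] := wu i; rewrite mulf_eq0 => /orP[] /eqP ->.
  by rewrite subr0 addr0 ger0_norm.
by rewrite sub0r add0r normrN ger0_norm.
Qed.

Lemma complementary_decomposition z :
  exists w u, complementary w u /\ z = u - w.
Proof.
(* The negative part comes first, as [w], and the positive part second, as [u]. *)
exists (map_mx (fun t => Num.max (- t) 0) z), (map_mx (Num.max^~ 0) z).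
split; last first.
  apply/matrixP => i j; rewrite !mxE.
  have [z0|z0] := leP 0 (z i j).
    by rewrite max_r ?oppr_le0 // subr0.
  by rewrite max_l ?oppr_ge0 1?ltW // sub0r opprK.
apply/complementaryP => i; rewrite !mxE.
split; rewrite ?le_max ?lexx ?orbT //.
have [z0|z0] := leP 0 (z i 0); last by rewrite mulr0.
by rewrite max_r ?oppr_le0 // mul0r.
Qed.

(* Each iteration of z |-> a + L |z| stabilizes one more coordinate. *)
Lemma absv_fixpoint_exists (L : 'M[R]_s) (a : 'cV[R]_s) :
  (forall i j : 'I_s, (i <= j)%N -> L i j = 0) ->
  exists z, z = a + L *m absv z.
Proof.
move=> L0; pose F z := a + L *m absv z.
have stab k (i : 'I_s) : (i < k)%N -> iter k F 0 i 0 = iter k.+1 F 0 i 0.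
  elim: k i => // k IHk i; rewrite ltnS => leik.
  rewrite 2!iterS [in RHS]/F [in LHS]/F !mxE; congr (_ + _).
  (* Row [i] of [L] only reads coordinates [j < i <= k], which are stable by induction. *)
  apply: eq_bigr => j _; have [leij|ltji] := leqP i j.
    by rewrite L0 // !mul0r.
  by rewrite [absv _ j 0]mxE [in RHS]mxE IHk // (leq_trans ltji).
(* Every index is below [s], so [s] rounds stabilize the whole vector. *)
exists (iter s F 0); rewrite -/(F _) -iterS.
by apply/matrixP => i j; rewrite ord1 stab.
Qed.

End Complementarity.

Section AbsNormalForm.
Variables (R : realType) (n m s : nat) (D : anf_data R n m s).
Implicit Types (x : 'cV[R]_n) (w u : 'cV[R]_s).

Lemma switching_eq_tilde x w u :
  u - w = anf_c D + anf_Z D *m x + anf_L D *m (u + w) <->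
  u = tilde_c D + tilde_Z D *m x + tilde_L D *m w.
Proof.
set L := anf_L D; set v := anf_c D + anf_Z D *m x.
have -> : tilde_c D + tilde_Z D *m x + tilde_L D *m w =
          invmx (1%:M - L) *m (v + (1%:M + L) *m w).
  by rewrite /tilde_c /tilde_Z /tilde_L -!mulmxA -!mulmxDr.
have UL := unitmx_1subL D; clearbody v.
(* Gathering [u] on the left and [w] on the right is reversible; only then is [1%:M - L]
   inverted. *)
have eqE : (u - w == v + L *m (u + w)) =
           ((1%:M - L) *m u == v + (1%:M + L) *m w).
  rewrite mulmxBl mulmxDl !mul1mx mulmxDr !subr_eq -!addrA.
  congr (_ == _); congr (_ + _).
  by rewrite addrC [L *m w + w]addrC -addrA.
split=> [/eqP | uE]; first by rewrite eqE => /eqP <-; rewrite mulKmx.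
by apply/eqP; rewrite eqE uE mulKVmx.
Qed.

(** The slack minus [w] solves the switching equation, so [abs_normal_form] applies to it. Both
    directions of the equivalence rest on this formula. *)
Lemma anf_eval (f : 'cV[R]_n -> 'cV[R]_m) x w :
  abs_normal_form f D ->
  complementary w (tilde_c D + tilde_Z D *m x + tilde_L D *m w) ->
  f x = tilde_b D + tilde_J D *m x + tilde_Y D *m w.
Proof.
set u := tilde_c D + _ + _ => fD /absv_sub_complementary absE.
rewrite (fD x (u - w)) absE; last by apply/switching_eq_tilde.
rewrite /u /tilde_b /tilde_J /tilde_Y.
move: (tilde_c D) (tilde_Z D) (tilde_L D) => c Z L.
rewrite !mulmxDl -!mulmxA !mulmxDl mul1mx !mulmxDr -!addrA; congr (_ + _).
by rewrite [LHS]addrCA [anf_Y D *m w + _]addrC.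
Qed.

(** Supplies the witness when [f x = 0] is given: [abs_normal_form] speaks about every solution [z]
    but does not assert that one exists. *)
Lemma complementary_tilde_exists x :
  exists w, complementary w (tilde_c D + tilde_Z D *m x + tilde_L D *m w).
Proof.
have [z zE] := absv_fixpoint_exists (anf_c D + anf_Z D *m x)
  (@anf_L_strict_lower _ _ _ _ D).
have [w [u [wu zuw]]] := complementary_decomposition z.
exists w; suff /switching_eq_tilde <- :
  u - w = anf_c D + anf_Z D *m x + anf_L D *m (u + w) by [].
by rewrite -(absv_sub_complementary wu) -zuw.
Qed.

Lemma anf_zero_mlcp (f : 'cV[R]_n -> 'cV[R]_m) x :
  abs_normal_form f D -> f x = 0 <-> exists w, solves_mlcp D x w.
Proof.
move=> fD; split=> [fx0 | [w [E wu]]]; last by rewrite (anf_eval fD wu).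
have [w wu] := complementary_tilde_exists x.
by exists w; split=> //; rewrite -(anf_eval fD wu).
Qed.

End AbsNormalForm.

Lemma solves_mlcp_lcp (R : realType) (n s : nat) (D : anf_data R n n s)
    (x : 'cV[R]_n) (w : 'cV[R]_s) :
  tilde_J D \in unitmx ->
  solves_mlcp D x w <->
  tilde_J D *m x = - tilde_b D - tilde_Y D *m w /\ solves_lcp D w.
Proof.
move=> UJ.
have eqJ : 0 = tilde_b D + tilde_J D *m x + tilde_Y D *m w <->
           tilde_J D *m x = - tilde_b D - tilde_Y D *m w.
  rewrite -opprD addrAC addrC; split=> [/esym/eqP|->]; last by rewrite addNr.
  by rewrite addr_eq0 => /eqP.
(* Solving the linear equation for [x] and substituting turns the mixed slack into the one of the
   reduced problem. *)
have uE : tilde_J D *m x = - tilde_b D - tilde_Y D *m w ->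
    check_c D + check_S D *m w = tilde_c D + tilde_Z D *m x + tilde_L D *m w.
  move=> Jx; rewrite -[x](mulKmx UJ) Jx /check_c /check_S mulmxBl !mulmxBr.
  rewrite !mulmxN !mulmxA -!addrA; congr (_ + (_ + _)).
  by rewrite addrC.
rewrite /solves_mlcp /solves_lcp.
by split=> -[/eqJ Jx wu]; split; rewrite ?uE // -?uE //; apply/eqJ.
Qed.

Theorem theorem3p1 (R : realType) :
  (forall (n m s : nat) (f : 'cV[R]_n -> 'cV[R]_m) (D : anf_data R n m s),
     piecewise_affine f -> abs_normal_form f D ->
     forall x : 'cV[R]_n,
       f x = 0 <-> exists w : 'cV[R]_s, solves_mlcp D x w) /\
  (forall (n s : nat) (f : 'cV[R]_n -> 'cV[R]_n) (D : anf_data R n n s),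
     piecewise_affine f -> abs_normal_form f D ->
     tilde_J D \in unitmx ->
     forall x : 'cV[R]_n,
       f x = 0 <->
       exists w : 'cV[R]_s,
         tilde_J D *m x = - tilde_b D - tilde_Y D *m w /\ solves_lcp D w).
Proof.
split=> [n m s f D _ fD x | n s f D _ fD UJ x]; first exact: anf_zero_mlcp.
rewrite (anf_zero_mlcp x fD).
by split=> -[w wP]; exists w; apply/(solves_mlcp_lcp x w UJ).
Qed.
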